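(* Let $V:\mathcal{K}^n\to\mathbb{R}$ be a translation invariant weakly additive map that is $n$-homogeneous and bounded on $\mathcal{K}(B)$ (that is, $\sup_{K\in\mathcal{K}(B)}|V(K)|<\infty$). Then $V$ is proportional to the Lebesgue measure on $\mathbb{R}^n$, i.e. there exists $c\in\mathbb{R}$ such that $V(K)=c\,\mathrm{Vol}(K)$ for every $K\in\mathcal{K}^n$.
   Context: $\mathcal{K}^n$ is the set of convex bodies of $\mathbb{R}^n$, i.e. the nonempty compact convex subsets of $\mathbb{R}^n$ ($n\ge 1$). $B$ is the closed Euclidean unit ball of $\mathbb{R}^n$ and $\mathcal{K}(B)=\{K\in\mathcal{K}^n: K\subset B\}$. $\mathrm{Vol}$ is the Lebesgue measure on $\mathbb{R}^n$. A map $V:\mathcal{K}^n\to\mathbb{R}$ is weakly additive if for every hyperplane $H$ with corresponding closed halfspaces $H^-$ and $H^+$ the relation $V(K)+V(K\cap H)=V(K\cap H^+)+V(K\cap H^-)$ holds whenever $K,K\cap H,K\cap H^+,K\cap H^-\in\mathcal{K}^n$. It is translation invariant if $V(K+x)=V(K)$ for all $K\in\mathcal{K}^n$, $x\in\mathbb{R}^n$. It is $\alpha$-homogeneous if $V(\lambda K)=\lambda^\alpha V(K)$ for every $\lambda\ge 0$ and $K\in\mathcal{K}^n$, where $\lambda K=\{\lambda a:a\in K\}$. *)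

(* Defs.v *)
From HB Require Import structures.
From mathcomp Require Import all_boot all_order all_algebra.
From mathcomp Require Import all_classical all_reals all_analysis.

Set Implicit Arguments.
Unset Strict Implicit.
Unset Printing Implicit Defensive.

Import Order.TTheory GRing.Theory Num.Theory.
Import numFieldNormedType.Exports.

Local Open Scope classical_set_scope.
Local Open Scope ring_scope.

(* [`|x|] on ['rV[R]_n] is the max norm of the library, which defines the usual
   topology of R^n but not the Euclidean ball. *)
Definition dotprod (R : realType) (n : nat) (x y : 'rV[R]_n) : R :=
  \sum_(i < n) x ord0 i * y ord0 i.

Definition enorm (R : realType) (n : nat) (x : 'rV[R]_n) : R :=
  Num.sqrt (dotprod x x).

Definition unit_eball (R : realType) (n : nat) : set 'rV[R]_n :=
  [set x | enorm x <= 1].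
Arguments unit_eball : clear implicits.

Definition hyperplane (R : realType) (n : nat) (u : 'rV[R]_n) (a : R) :
    set 'rV[R]_n := [set x | dotprod u x = a].

Definition halfspace_le (R : realType) (n : nat) (u : 'rV[R]_n) (a : R) :
    set 'rV[R]_n := [set x | dotprod u x <= a].

Definition halfspace_ge (R : realType) (n : nat) (u : 'rV[R]_n) (a : R) :
    set 'rV[R]_n := [set x | a <= dotprod u x].

Definition convex_body (R : realType) (n : nat) (K : set 'rV[R]_n) : Prop :=
  [/\ K !=set0, compact K & convex_set (K : set (convex_lmodType 'rV[R]_n))].

(* A functional on convex bodies is represented by a function on all sets; its
   values on sets that are not convex bodies are never constrained or used. *)

Definition weakly_additive (R : realType) (n : nat) (V : set 'rV[R]_n -> R) :=
  forall (u : 'rV[R]_n) (a : R) (K : set 'rV[R]_n), u != 0 ->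
    convex_body K ->
    convex_body (K `&` hyperplane u a) ->
    convex_body (K `&` halfspace_ge u a) ->
    convex_body (K `&` halfspace_le u a) ->
    V K + V (K `&` hyperplane u a) =
      V (K `&` halfspace_ge u a) + V (K `&` halfspace_le u a).

Definition translation_invariant (R : realType) (n : nat)
    (V : set 'rV[R]_n -> R) :=
  forall (K : set 'rV[R]_n) (x : 'rV[R]_n), convex_body K ->
    V [set y + x | y in K] = V K.

Definition homogeneous (R : realType) (n : nat) (alpha : R)
    (V : set 'rV[R]_n -> R) :=
  forall (l : R) (K : set 'rV[R]_n), 0 <= l -> convex_body K ->
    V [set l *: y | y in K] = l `^ alpha * V K.

Definition bounded_on_unit_eball (R : realType) (n : nat)
    (V : set 'rV[R]_n -> R) :=
  exists M : R, forall K : set 'rV[R]_n, convex_body K ->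
    K `<=` unit_eball R n -> `|V K| <= M.

(* The n-fold product of the one-dimensional Lebesgue measure, on the product
   sigma-algebra of [n.-tuple R], which is the Borel sigma-algebra of R^n. *)
Fixpoint lebesgue_tuple (R : realType) (n : nat) :
    set (n.-tuple (measurableTypeR R)) -> \bar R :=
  match n with
  | 0%N => dirac [tuple]
  | m.+1 => pushforward (lebesgue_measure \x @lebesgue_tuple R m)%E
      (fun p : measurableTypeR R * m.-tuple (measurableTypeR R) =>
         [tuple of p.1 :: p.2])
  end.
Arguments lebesgue_tuple : clear implicits.

Definition Vol (R : realType) (n : nat) (A : set 'rV[R]_n) : \bar R :=
  lebesgue_tuple R n [set t | A (\row_i tnth t i)].

Section lebesgue_tuple_measure.
Local Open Scope ereal_scope.
Variable R : realType.

Let T := measurableTypeR R.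
Let tcons (m : nat) (p : T * m.-tuple T) : m.+1.-tuple T :=
  [tuple of p.1 :: p.2].

Let measurable_tcons m : measurable_fun [set: T * m.-tuple T] (@tcons m).
Proof. exact: measurable_cons. Qed.

Let sigma_finite_pack d (X : measurableType d) (nu : set X -> \bar R) :
  nu set0 = 0 -> (forall A, 0 <= nu A) -> semi_sigma_additive nu ->
  sigma_finite setT nu ->
  exists mu : {sigma_finite_measure set X -> \bar R},
    nu = mu :> (set X -> \bar R).
Proof.
move=> nu0 nu_ge0 nu_sa nu_sf.
pose nu_m := isMeasure.Build _ _ _ nu nu0 nu_ge0 nu_sa.
pose nuM : {measure set X -> \bar R} := HB.pack nu nu_m.
pose nu_s := Measure_isSigmaFinite.Build _ _ _ nuM nu_sf.
by exists (HB.pack_for {sigma_finite_measure set X -> \bar R} nu nu_m nu_s).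
Qed.

Lemma lebesgue_tuple_sigma_finite (n : nat) :
  exists mu : {sigma_finite_measure set (n.-tuple T) -> \bar R},
    lebesgue_tuple R n = mu.
Proof.
elim: n => [|n [mu IH]] /=; first by eexists (dirac _).
rewrite IH.
pose nu := pushforward (lebesgue_measure \x mu) (@tcons n).
have nu0 : nu set0 = 0 by rewrite /nu /pushforward preimage_set0 measure0.
have nu_ge0 A : 0 <= nu A by rewrite /nu /pushforward measure_ge0.
have nu_sa : semi_sigma_additive nu.
  move=> F mF tF mUF; rewrite /nu /pushforward preimage_bigcup.
  have mpre A : measurable A -> measurable (@tcons n @^-1` A).
    by move=> mA; rewrite -[X in measurable X]setTI; exact: measurable_tcons.
  apply: measure_semi_sigma_additive.
  - by move=> k; exact: mpre.
  - apply/trivIsetP => /= i j _ _ ij; rewrite -preimage_setI.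
    by move/trivIsetP : tF => /(_ _ _ _ _ ij) -> //; rewrite preimage_set0.
  - by rewrite -preimage_bigcup; exact: mpre.
have nu_sf : sigma_finite setT nu.
  have [F FT Foo] : sigma_finite setT (lebesgue_measure \x mu).
    have /sigma_finiteP[G [TG ndG Goo]] :=
      sigma_finiteT (lebesgue_measure : {sigma_finite_measure set T -> \bar R}).
    have /sigma_finiteP[H [TH ndH Hoo]] := sigma_finiteT mu.
    exists (fun k => G k `*` H k).
      apply/seteqP; split => // -[x y] _.
      have [i _ Gix] : (\bigcup_k G k) x by rewrite -TG.
      have [j _ Hjy] : (\bigcup_k H k) y by rewrite -TH.
      exists (maxn i j) => //; split.
        by move: x Gix; exact/subsetPset/ndG/leq_maxl.
      by move: y Hjy; exact/subsetPset/ndH/leq_maxr.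
    move=> k; have [? ?] := Goo k; have [? ?] := Hoo k.
    split; first exact: measurableX.
    by rewrite product_measure1E // lte_mul_pinfty // ge0_fin_numE.
  pose g (t : n.+1.-tuple T) : T * n.-tuple T :=
    (tnth t ord0, [tuple of behead t]).
  have gK : cancel (@tcons n) g.
    by move=> [x t]; congr (_, _); exact/val_inj.
  have mg : measurable_fun setT g.
    apply: measurable_fun_pair; first exact: measurable_tnth.
    exact: measurable_behead.
  exists (fun k => g @^-1` F k).
    by rewrite -preimage_bigcup -FT preimage_setT.
  move=> k; have [mFk Fkoo] := Foo k; split.
    by rewrite -[X in measurable X]setTI; exact: mg.
  rewrite /nu /pushforward -comp_preimage.
  by rewrite (_ : g \o _ = id) //; apply/funext => x /=; exact: gK.
exact: sigma_finite_pack.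
Qed.

Lemma lebesgue_tuple_box (n : nat) (A : 'I_n -> set T) :
  (forall i, measurable (A i)) ->
  lebesgue_tuple R n [set t | forall i, A i (tnth t i)] =
    \prod_(i < n) lebesgue_measure (A i).
Proof.
elim: n A => [|n IH] A mA /=.
  by rewrite big_ord0 diracE mem_set // => -[].
rewrite big_ord_recl -IH; last by move=> i; exact: mA.
have [mu muE] := lebesgue_tuple_sigma_finite n.
rewrite muE /pushforward -product_measure1E //=.
  congr (_ _); apply/seteqP; split => [[x t] /= h|[x t] /= [h0 h1] i].
    split; first exact: (h ord0).
    by move=> i; have := h (lift ord0 i); rewrite tnthS.
  case: (unliftP ord0 i) => [j ->|->] //.
  by rewrite tnthS; exact: h1.
rewrite (_ : [set t | _] =
    \bigcap_(i in [set: 'I_n]) ((fun t => tnth t i) @^-1` A (lift ord0 i))).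
  apply: fin_bigcap_measurable => // i _.
  by rewrite -[X in measurable X]setTI; exact: measurable_tnth.
by apply/seteqP; split => t /= h i; [move=> _|]; exact: h.
Qed.

End lebesgue_tuple_measure.

(* Main.v *)
Require Import Defs.
From mathcomp Require Import all_boot all_order all_algebra.
From mathcomp Require Import all_classical all_reals all_analysis.
From mathcomp Require Import ring lra.

(** Why the theorem is true.  Let c be the value of V on the unit cube and put
    W = V - c Vol, extended by 0 to the empty set.  W is additive for cuts along
    coordinate hyperplanes, vanishes on every cube, and satisfies
    |W K| <= C r^n whenever all coordinate widths of K are at most r: for V this
    is homogeneity, translation invariance and boundedness on the unit ball; for
    Vol it is the volume of a cube containing K.  These properties alone force
    W = 0 ([additive_vanish]).  The constant C improves itself: cut a body of
    width r into cells of width r/3, apply the bound C (r/3)^n to each cell, and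
    find that a smaller constant works, so that every constant works.

    The self-improvement is used twice.  If K is constant in at least one
    coordinate ([flat_vanish]), thirds are taken in the others only: there are at
    most 3^(n-1) cells, so C can be replaced by C/3.  This makes the term
    W (K `&` H) disappear from weak additivity.  For a general K contained in a
    cube, all n coordinates are cut and there are 3^n cells, so that one cell on
    which W vanishes is enough to replace C by (1 - 3^-n) C.  There always is
    one, by convexity ([empty_corner_or_central_cell]): either K misses one of
    the 2^n corner cells, or it meets all of them and then contains the central
    cell, so that K meets that cell in a cube. *)

Set Implicit Arguments.
Unset Strict Implicit.
Unset Printing Implicit Defensive.

Import Order.TTheory GRing.Theory Num.Theory.
Import numFieldNormedType.Exports.

Local Open Scope classical_set_scope.
Local Open Scope ring_scope.

(** * Compact convex sets, coordinate cuts and cells *)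

Section Geometry.
Context {R : realType} {n : nat}.
Implicit Types (K A : set 'rV[R]_n) (p : 'I_n -> R) (i : 'I_n) (s : seq 'I_n).

Definition segment_closed K := forall x y (t : R), K x -> K y ->
  0 <= t <= 1 -> K (t *: x + (1 - t) *: y).

Lemma convex_setE K :
  convex_set (K : set (convex_lmodType 'rV[R]_n)) <-> segment_closed K.
Proof.
split=> [cK x y t Kx Ky /andP[t0 t1]|cK x y l /set_mem Kx /set_mem Ky].
  by have := cK x y (Itv01 t0 t1) (mem_set Kx) (mem_set Ky); rewrite inE.
by apply/mem_set/cK => //; rewrite ge0 le1.
Qed.

(** The empty set is admitted, so that the class is stable under every cut. *)
Definition convex_compact K := compact K /\ segment_closed K.

Lemma convex_bodyE K : convex_body K <-> convex_compact K /\ K !=set0.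
Proof.
by split=> [[K0 cK /convex_setE]|[[cK /convex_setE cvK] K0]].
Qed.

Definition coord_le i (a : R) : set 'rV[R]_n := [set x | x ord0 i <= a].
Definition coord_ge i (a : R) : set 'rV[R]_n := [set x | a <= x ord0 i].
Definition coord_eq i (a : R) : set 'rV[R]_n := [set x | x ord0 i = a].

Lemma convex_compactI K A : convex_compact K -> closed A -> segment_closed A ->
  convex_compact (K `&` A).
Proof.
move=> [coK cvK] clA cvA; split; first exact: compact_closedI.
by move=> x y t [Kx Ax] [Ky Ay] t01; split; [exact: cvK|exact: cvA].
Qed.

Lemma coord_leI K i a : convex_compact K -> convex_compact (K `&` coord_le i a).
Proof.
move=> cK; apply: convex_compactI => //.
  apply: (@preimage_closed _ _ (fun x : 'rV[R]_n => x ord0 i) [set y | y <= a]).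
    by move=> x _; exact: coord_continuous.
  exact: closed_le.
by move=> x y t; rewrite /coord_le /= !mxE; nra.
Qed.

Lemma coord_geI K i a : convex_compact K -> convex_compact (K `&` coord_ge i a).
Proof.
move=> cK; apply: convex_compactI => //.
  apply: (@preimage_closed _ _ (fun x : 'rV[R]_n => x ord0 i) [set y | a <= y]).
    by move=> x _; exact: coord_continuous.
  exact: closed_ge.
by move=> x y t; rewrite /coord_ge /= !mxE; nra.
Qed.

Lemma coord_eqI K i a : convex_compact K -> convex_compact (K `&` coord_eq i a).
Proof.
move=> cK; rewrite (_ : _ `&` _ = K `&` coord_le i a `&` coord_ge i a).
  exact/coord_geI/coord_leI.
rewrite -setIA; congr (_ `&` _); apply/seteqP; split=> x /=.
  by rewrite /coord_eq /coord_le /coord_ge /= => ->.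
by move=> [/= xa ax]; apply/eqP; rewrite eq_le xa.
Qed.

(** Containment in some cube of side [r], in a form that does not refer to the
    position of the cube. *)
Definition width_le (r : R) K :=
  forall x y i, K x -> K y -> x ord0 i - y ord0 i <= r.

Lemma compact_width_le K : compact K -> exists2 r, 0 <= r & width_le r K.
Proof.
move=> /compact_bounded[M [Mr KM]].
have {}KM x : K x -> forall i, `|x ord0 i| <= `|M| + 1.
  move=> Kx i; have /(KM _) /(_ x Kx) : M < `|M| + 1.
    by rewrite (le_lt_trans (ler_norm M)) // ltrDl.
  apply: le_trans.
  have /mapP[j Hj ->] : `|x ord0 i| \in [seq `|x k.1 k.2| | k : 'I_1 * 'I_n].
    by apply/mapP; exists (ord0, i) => //=; rewrite mem_enum.
  by rewrite [leRHS]/Num.norm /= mx_normrE; apply/bigmax_geP; right => /=; exists j.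
exists ((`|M| + 1) *+ 2) => [|x y i /KM/(_ i) + /KM/(_ i)].
  by rewrite mulrn_wge0 // addr_ge0.
by rewrite !ler_norml mulr2n; lra.
Qed.

Definition cube p (r : R) : set 'rV[R]_n :=
  [set x | forall i, p i <= x ord0 i <= p i + r].

Lemma width_le_cube r K : width_le r K -> exists p, K `<=` cube p r.
Proof.
move=> wK; exists (fun i => inf [set x ord0 i | x in K]) => x Kx i.
have lb : has_lbound [set x ord0 i | x in K].
  by exists (x ord0 i - r) => _ [y Ky <-]; have := wK x y i Kx Ky; lra.
apply/andP; split; first by apply: ge_inf => //; exists x.
rewrite -lerBlDr; apply: lb_le_inf; first by exists (x ord0 i), x.
by move=> _ [y Ky <-]; have := wK x y i Kx Ky; lra.
Qed.

Lemma convex_compact_cube p r : convex_compact (cube p r).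
Proof.
split.
  apply: (@rV_compact R n (fun i => `[p i, p i + r]%classic)) => i.
  exact: segment_compact.
move=> x y t cx cy /andP[t0 t1] i; rewrite !mxE.
have /andP[? ?] := cx i; have /andP[? ?] := cy i; apply/andP; split; nra.
Qed.

Definition third p (r : R) i (k : 'I_3) : set 'rV[R]_n :=
  [set x | p i + k%:R * (r / 3) <= x ord0 i <= p i + k.+1%:R * (r / 3)].

Lemma between_convex_comb (a b c : R) : a <= c -> c <= b ->
  exists2 t : R, 0 <= t <= 1 & t * b + (1 - t) * a = c.
Proof.
move=> ac cb; have [ab|ab] := eqVneq b a.
  exists 1; rewrite ?ler01 ?lexx // mul1r subrr mul0r addr0.
  by apply/eqP; rewrite eq_le cb ab ac.
have ab0 : 0 < b - a by rewrite subr_gt0 lt_neqAle eq_sym ab; lra.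
exists ((c - a) / (b - a)); last by field; rewrite gt_eqF.
by rewrite divr_ge0 /= ?ler_pdivrMr //; lra.
Qed.

(** Two points of [K] whose i-th coordinates lie on either side of [y i] can be
    replaced by a point between them that agrees with [y] in that coordinate.
    Doing so for each coordinate in turn, simultaneously for all orthants, brings
    a point of [K] onto [y]. *)
Lemma sub_orthants_mem K (y : 'rV[R]_n) : segment_closed K ->
  (forall e : 'I_n -> bool, exists2 x, K x &
    forall i, if e i then y ord0 i <= x ord0 i else x ord0 i <= y ord0 i) ->
  K y.
Proof.
move=> cvK orth.
have H s (e : 'I_n -> bool) : exists2 x, K x & forall i, if i \in s
    then x ord0 i = y ord0 i
    else if e i then y ord0 i <= x ord0 i else x ord0 i <= y ord0 i.
  elim: s e => [|j s IH] e; first exact: orth.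
  have [js|jNs] := boolP (j \in s).
    have [x Kx xy] := IH e; exists x => // i; have := xy i.
    by rewrite in_cons; case: (eqVneq i j) => [->|//]; rewrite js.
  (* [e] is overridden at [j] only, so [u] and [v] satisfy the same sign
     conditions in the remaining coordinates, as does every point between them. *)
  have [u Ku uy] := IH (fun i => (i == j) || e i).
  have [v Kv vy] := IH (fun i => (i != j) && e i).
  have := uy j; have := vy j; rewrite (negbTE jNs) eqxx /= => vj uj.
  have [t t01 tE] := between_convex_comb vj uj.
  exists (t *: u + (1 - t) *: v); first exact: cvK.
  move=> i; rewrite in_cons !mxE; case: (eqVneq i j) => [->//|ij] /=.
  have := uy i; have := vy i; rewrite (negbTE ij) /=; move/andP: t01 => [t0 t1].
  by case: ifP => _; [|case: ifP => _]; nra.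
have [x Kx xy] := H (enum 'I_n) xpredT.
rewrite (_ : y = x) //; apply/rowP => i; have := xy i.
by rewrite mem_enum inE => ->.
Qed.

(** Here convexity enters: from a point of the central cell, the corner cells lie
    one in each closed orthant, so [sub_orthants_mem] applies if [K] meets all of
    them.  The resulting assignment [z] of a third to each coordinate designates
    the cell that is left out of the count. *)
Lemma empty_corner_or_central_cell p r K : 0 <= r -> segment_closed K ->
  exists z : 'I_n -> 'I_3,
    K `&` [set x | forall i, third p r i (z i) x] = set0 \/
    exists p', K `&` [set x | forall i, third p r i (z i) x] = cube p' (r / 3).
Proof.
move=> r0 cvK.
pose corner (e : 'I_n -> bool) i : 'I_3 := if e i then ord_max else ord0.
have [[e Ke]|Ne] := pselect (exists e,
    K `&` [set x | forall i, third p r i (corner e i) x] = set0).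
  by exists (corner e); left.
exists (fun=> @Ordinal 3 1 isT); right; exists (fun i => p i + r / 3).
have -> : [set x : 'rV[R]_n | forall i, third p r i (@Ordinal 3 1 isT) x] =
    cube (fun i => p i + r / 3) (r / 3).
  by apply/seteqP; split=> x /= cx i; have := cx i; rewrite /third /=; lra.
apply: setIidr => y cy; apply: sub_orthants_mem => // e.
have [x [Kx cx]] : (K `&` [set x | forall i, third p r i (corner e i) x]) !=set0.
  by apply/set0P/eqP => Ke; apply: Ne; exists e.
exists x => // i; have := cx i; have := cy i; rewrite /third /corner /=.
by case: (e i) => /=; lra.
Qed.
End Geometry.

(** * Coordinatewise additive functionals that vanish on cubes *)

Section Valuations.
Context {R : realType} {n : nat}.
Implicit Types (K A : set 'rV[R]_n) (p : 'I_n -> R) (i : 'I_n) (s : seq 'I_n).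
Implicit Types W : set 'rV[R]_n -> R.

(** Weak additivity for coordinate hyperplanes only.  Thanks to [W set0 = 0] no
    intersection has to be nonempty. *)
Definition coord_additive W := W set0 = 0 /\
  forall i a K, convex_compact K ->
    W K + W (K `&` coord_eq i a) = W (K `&` coord_ge i a) + W (K `&` coord_le i a).

Definition width_bounded_on (P : set (set 'rV[R]_n)) W (C : R) :=
  forall r K, 0 <= r -> convex_compact K -> P K -> width_le r K ->
    `|W K| <= C * r ^+ n.

(** The self-improvement principle: if each bounding constant can be multiplied
    by a fixed [q < 1], then iterating gives [`|W K| <= C q^m r^n] for all [m]. *)
Lemma width_bounded_vanish (P : set (set 'rV[R]_n)) W (C q : R) K :
  0 <= q < 1 -> 0 <= C -> width_bounded_on P W C ->
  (forall D, 0 <= D -> width_bounded_on P W D ->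
    width_bounded_on P W (q * D)) ->
  convex_compact K -> P K -> W K = 0.
Proof.
move=> /andP[q0 q1] C0 WC step cK PK.
have [r r0 wK] := compact_width_le cK.1.
have bnd m : `|W K| <= geometric (C * r ^+ n) q m.
  rewrite /geometric /= mulrAC (mulrC C).
  suff [_] : 0 <= q ^+ m * C /\ width_bounded_on P W (q ^+ m * C).
    by apply.
  elim: m => [|m [qC0 IH]]; first by rewrite expr0 mul1r.
  by rewrite exprS -mulrA; split; [exact: mulr_ge0|exact: step].
apply/eqP; rewrite -normr_le0.
have cvg0 : geometric (C * r ^+ n) q @ \oo --> 0.
  by apply: cvg_geometric; rewrite ger0_norm.
rewrite -(cvg_lim _ cvg0) //; apply: limr_ge; first by apply/cvgP: cvg0.
by apply: nearW => m; exact: bnd.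
Qed.

(** Additivity without the correction term on the hyperplane; it is stated for
    the subsets of [K] so that it passes to all pieces of an iterated cut. *)
Definition cut_additive W i K := forall A a, convex_compact A -> A `<=` K ->
  W A = W (A `&` coord_le i a) + W (A `&` coord_ge i a).

Lemma sub_cut_additive W i K A : A `<=` K -> cut_additive W i K ->
  cut_additive W i A.
Proof. by move=> AK WK A' a cA' /subset_trans/(_ AK); exact: WK. Qed.

Lemma thirdI p r i (k : 'I_3) K :
  convex_compact K -> convex_compact (K `&` third p r i k).
Proof.
move=> cK; rewrite (_ : K `&` _ = K `&` coord_ge i (p i + k%:R * (r / 3))
    `&` coord_le i (p i + k.+1%:R * (r / 3))).
  exact/coord_leI/coord_geI.
by rewrite -setIA; congr (_ `&` _); apply/seteqP; split=> x /=;
  rewrite /third /coord_le /coord_ge /=; [move/andP|move=> [-> ->]].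
Qed.

Lemma cut_thirds W p r i K : 0 <= r -> convex_compact K -> K `<=` cube p r ->
  cut_additive W i K -> W K = \sum_(k < 3) W (K `&` third p r i k).
Proof.
move=> r0 cK Kp WK; rewrite !big_ord_recr big_ord0 /= add0r.
rewrite (WK K (p i + r / 3)) // -addrA; congr (_ + _).
  congr W; apply/seteqP; split=> x [Kx]; have := Kp x Kx i;
    rewrite /coord_le /third /=; split=> //; lra.
rewrite (WK _ (p i + 2 * (r / 3)));
  [|exact: coord_geI|by move=> ? []].
congr (_ + _); congr W; apply/seteqP; split=> x.
- by move=> [[Kx]]; have := Kp x Kx i; rewrite /coord_le /coord_ge /third /=;
    split=> //; lra.
- move=> [Kx]; have := Kp x Kx i; rewrite /coord_le /coord_ge /third /= => ? ?.
  by split; [split=> //|]; lra.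
- by move=> [[Kx]]; have := Kp x Kx i; rewrite /coord_le /coord_ge /third /=;
    split=> //; lra.
- move=> [Kx]; have := Kp x Kx i; rewrite /coord_le /coord_ge /third /= => ? ?.
  by split; [split=> //|]; lra.
Qed.

Definition cell p r s (z : 'I_n -> 'I_3) : set 'rV[R]_n :=
  [set x | forall i, i \in s -> third p r i (z i) x].

Lemma cell_cons p r j s z :
  cell p r (j :: s) z = third p r j (z j) `&` cell p r s z.
Proof.
apply/seteqP; split=> x.
  by move=> c; split=> [|i si]; apply: c; rewrite in_cons ?eqxx ?si ?orbT.
by move=> [cj c] i; rewrite in_cons => /orP[/eqP->|/c].
Qed.

Lemma cellI p r s z K : convex_compact K -> convex_compact (K `&` cell p r s z).
Proof.
elim: s K => [|j s IH] K cK; first by rewrite (_ : K `&` _ = K) //; apply: setIidl.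
by rewrite cell_cons setIA; exact/IH/thirdI.
Qed.

(** Cutting along the coordinates of [s] gives [3 ^ size s] cells; the one that
    [z] designates is kept apart, and [B] bounds [W] on each of the others. *)
Lemma cut_bound W p r (B : R) s (z : 'I_n -> 'I_3) K :
  0 <= r -> convex_compact K -> K `<=` cube p r ->
  (forall i, i \in s -> cut_additive W i K) ->
  (forall A, convex_compact A -> A `<=` K ->
     (forall x y i, i \in s -> A x -> A y -> x ord0 i - y ord0 i <= r / 3) ->
     `|W A| <= B) ->
  `|W K| <= `|W (K `&` cell p r s z)| + (3 ^+ size s - 1) * B.
Proof.
move=> r0; elim: s K => [|j s IH] K cK Kp Wadd WB.
  rewrite expr0 subrr mul0r addr0 (_ : K `&` _ = K) //.
  by apply: setIidl.
have sub k : K `&` third p r j k `<=` K by move=> x [].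
have WBk k A : convex_compact A -> A `<=` K `&` third p r j k ->
    (forall x y i, i \in s -> A x -> A y -> x ord0 i - y ord0 i <= r / 3) ->
    `|W A| <= B.
  move=> cA AK wA; apply: WB => //; first exact: subset_trans (sub k).
  move=> x y i; rewrite in_cons => /orP[/eqP->|]; last exact: wA.
  by move=> /AK[_ +] /AK[_]; rewrite /third /=; lra.
have IHk k : `|W (K `&` third p r j k)| <=
    `|W (K `&` third p r j k `&` cell p r s z)| + (3 ^+ size s - 1) * B.
  apply: IH (WBk k); first exact: thirdI.
    exact: subset_trans Kp.
  move=> i si; apply: sub_cut_additive (Wadd i _) => //.
  by rewrite in_cons si orbT.
have IHk' k : `|W (K `&` third p r j k)| <= 3 ^+ size s * B.
  apply: le_trans (IHk k) _; rewrite mulrBl mul1r addrCA gerDl subr_le0.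
  apply: (WBk k); [exact/cellI/thirdI|by move=> x []|].
  by move=> x y i si [_ /(_ i si)] + [_ /(_ i si)]; rewrite /third /=; lra.
rewrite (cut_thirds r0 cK Kp (Wadd _ (mem_head _ _))) (bigD1 (z j)) //=.
apply: le_trans (ler_normD _ _) _.
rewrite cell_cons setIA exprS.
have -> : (3 * 3 ^+ size s - 1) * B =
    (3 ^+ size s - 1) * B + \sum_(k < 3 | k != z j) 3 ^+ size s * B.
  by rewrite sumr_const cardC1 card_ord /= mulr2n; ring.
rewrite addrA lerD //; apply: le_trans (ler_norm_sum _ _ _) _.
by apply: ler_sum => k _; exact: IHk'.
Qed.

(** Such a [K] lies in a translate of the span of the coordinate axes listed
    in [s], so that its dimension is at most [size s]. *)
Definition flat_off s K := forall x y i, i \notin s -> K x -> K y ->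
  x ord0 i = y ord0 i.

Lemma coord_additive_cut W i K : coord_additive W ->
  (forall A a, convex_compact A -> A `<=` K -> W (A `&` coord_eq i a) = 0) ->
  cut_additive W i K.
Proof.
move=> [_ Wadd] Weq A a cA AK.
by have := Wadd i a A cA; rewrite Weq // addr0 addrC.
Qed.

(** Lower-dimensional sets are negligible for a functional bounded by the n-th
    power of the width.  The induction on [size s] serves to discard the sections
    by the hyperplanes along which [K] is cut: these are flat in one more
    coordinate. *)
Lemma flat_vanish W C s K : coord_additive W ->
  0 <= C -> width_bounded_on setT W C -> (size s < n)%N ->
  convex_compact K -> flat_off s K -> W K = 0.
Proof.
move=> Wadd C0 WC; have [m] := ubnP (size s); elim: m s K => // m IH s K sm sn.
apply: (width_bounded_vanish (q := 3^-1) (C := C)) => //.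
- by rewrite invr_ge0 ler0n invf_lt1 ?ltr1n.
- by move=> r A r0 cA _; exact: WC.
move=> D D0 WD r A r0 cA As wA.
have [p Ap] := width_le_cube wA.
have cut i : i \in s -> cut_additive W i A.
  move=> si; apply: coord_additive_cut => // E a cE EA.
  have ss : (size [seq j <- s | j != i] < size s)%N.
    by rewrite size_filter -(count_predC (pred1 i) s) -[ltnLHS]add0n
      ltn_add2r -has_count has_pred1.
  apply: (IH [seq j <- s | j != i]).
  - exact: leq_trans ss _.
  - exact: ltn_trans ss _.
  - exact: coord_eqI.
  - move=> x y j; rewrite mem_filter negb_and negbK.
    move=> /orP[/eqP->|sj] [Ex xa] [Ey ya]; first by rewrite xa ya.
    by apply: As => //; exact: EA.
have bnd E : convex_compact E -> E `<=` A ->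
    (forall x y i, i \in s -> E x -> E y -> x ord0 i - y ord0 i <= r / 3) ->
    `|W E| <= D * (r / 3) ^+ n.
  move=> cE EA wE; apply: WD => //; first by rewrite divr_ge0.
    by move=> x y i si Ex Ey; apply: As => //; exact: EA.
  move=> x y i Ex Ey; have [si|si] := boolP (i \in s); first exact: wE.
  by rewrite (As x y i si) ?subrr ?divr_ge0 //; exact: EA.
(* All cells satisfy the same bound, so the choice of [z] is arbitrary. *)
pose z : 'I_n -> 'I_3 := fun=> ord0.
apply: le_trans (cut_bound z r0 cA Ap cut bnd) _.
have cellB : `|W (A `&` cell p r s z)| <= D * (r / 3) ^+ n.
  apply: bnd; [exact: cellI|by move=> x []|].
  by move=> x y i si [_ /(_ i si)] + [_ /(_ i si)]; rewrite /third /=; lra.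
apply: le_trans (lerD cellB (lexx _)) _.
have key : 3 * 3 ^+ size s <= 3 ^+ n :> R by rewrite -exprS ler_weXn2l ?ler1n.
have P0 : 0 < 3 ^+ n :> R by rewrite exprn_gt0.
rewrite -subr_ge0 (_ : _ - _ =
    (3 ^+ n - 3 * 3 ^+ size s) * (D * r ^+ n) / (3 * 3 ^+ n)); last first.
  by rewrite expr_div_n; field; rewrite gt_eqF.
by rewrite divr_ge0 ?mulr_ge0 ?subr_ge0 ?exprn_ge0.
Qed.

(** Of the [3 ^ n] cells of [K], the one provided by
    [empty_corner_or_central_cell] contributes nothing, which improves [C] by the
    factor [1 - 3 ^- n]. *)
Theorem additive_vanish W C K : coord_additive W ->
  0 <= C -> width_bounded_on setT W C ->
  (forall p r, 0 <= r -> W (cube p r) = 0) ->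
  convex_compact K -> W K = 0.
Proof.
move=> Wadd C0 WC Wcube cK.
have cut i A : cut_additive W i A.
  apply: coord_additive_cut => // E a cE _.
  apply: (flat_vanish (s := [seq j <- enum 'I_n | j != i]) Wadd C0 WC).
  - rewrite size_filter -[ltnRHS]card_ord cardE.
    rewrite -(count_predC (pred1 i)) -[ltnLHS]add0n ltn_add2r -has_count has_pred1.
    by rewrite mem_enum.
  - exact: coord_eqI.
  - move=> x y j; rewrite mem_filter mem_enum andbT negbK => /eqP-> [_ xa] [_ ya].
    by rewrite xa ya.
apply: (width_bounded_vanish (q := 1 - (3 ^+ n)^-1) _ C0 WC) => //.
  rewrite subr_ge0 invf_le1 ?exprn_gt0 // exprn_ege1 ?ler1n //.
  by rewrite gtrDl oppr_lt0 invr_gt0 exprn_gt0.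
move=> D D0 WD r A r0 cA _ wA.
have [p Ap] := width_le_cube wA.
have [z zA] := empty_corner_or_central_cell p r0 cA.2.
have bnd E : convex_compact E -> E `<=` A ->
    (forall x y i, i \in enum 'I_n -> E x -> E y -> x ord0 i - y ord0 i <= r / 3) ->
    `|W E| <= D * (r / 3) ^+ n.
  move=> cE EA wE; apply: WD => //; first by rewrite divr_ge0.
  by move=> x y i; apply: wE; rewrite mem_enum.
apply: le_trans (cut_bound z r0 cA Ap (fun i _ => cut i A) bnd) _.
have cellE : cell p r (enum 'I_n) z = [set x | forall i, third p r i (z i) x].
  by apply/seteqP; split=> x /= c i => [|_]; apply: c; rewrite mem_enum.
rewrite cellE; have -> : W (A `&` [set x | forall i, third p r i (z i) x]) = 0.
  by have [->|[p' ->]] := zA; [exact: Wadd.1|rewrite Wcube ?divr_ge0].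
rewrite normr0 add0r size_enum_ord expr_div_n le_eqVlt; apply/orP; left; apply/eqP.
by field; rewrite expf_neq0 // pnatr_eq0.
Qed.
End Valuations.

(** * The Lebesgue volume of compact convex sets *)

Section Volume.
Context {R : realType} {n : nat}.
Implicit Types (K A U : set 'rV[R]_n) (p : 'I_n -> R) (i : 'I_n).
Local Notation T := (measurableTypeR R).

(** Volume is measured in the space of tuples; this is the copy of [A] there. *)
Definition tuple_set A : set (n.-tuple T) := [set t | A (\row_i tnth t i)].

Lemma measurable_tuple_box (B : 'I_n -> set T) :
  (forall i, measurable (B i)) ->
  measurable [set t : n.-tuple T | forall i, B i (tnth t i)].
Proof.
move=> mB; rewrite (_ : [set t | _] =
    \bigcap_(i in [set: 'I_n]) ((fun t => tnth t i) @^-1` B i)).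
  apply: fin_bigcap_measurable => // i _.
  by rewrite -[X in measurable X]setTI; exact: measurable_tnth.
by apply/seteqP; split => t /= h i; [move=> _|]; exact: h.
Qed.

(** The Borel sets of the topology of row vectors are measurable for the product
    sigma-algebra: an open set is the countable union of the open cubes with
    rational centre and side [2 / m.+1] that it contains. *)
Lemma measurable_open_tuple_set U : open U -> measurable (tuple_set U).
Proof.
move=> oU.
pose rbox (d c : R) : set T := `]c - d, c + d[%classic.
have rbox_sym (d b c : R) : b - d < c < b + d -> rbox d c b.
  by rewrite /rbox /= in_itv /=; lra.
have rbox_dist (d e b b' c : R) : d < e / 2 ->
    rbox d c b -> rbox d c b' -> `|b - b'| < e.
  by rewrite /rbox /= !in_itv /= ltr_norml; lra.
pose F (mq : nat * {ffun 'I_n -> rat}) : set (n.-tuple T) :=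
  if pselect (forall x : 'rV[R]_n,
    (forall i, rbox mq.1.+1%:R^-1 (ratr (mq.2 i)) (x ord0 i)) -> U x)
  then [set t | forall i, rbox mq.1.+1%:R^-1 (ratr (mq.2 i)) (tnth t i)] else set0.
have -> : tuple_set U = \bigcup_mq F mq.
  apply/seteqP; split=> [t Ut|t [mq _]]; last first.
    rewrite /F; case: pselect => //.
    by move=> boxU /= tF; apply: boxU => i; rewrite mxE; exact: tF.
  have /nbhs_ballP[e /= e0 eU] : nbhs (\row_i tnth t i) U.
    exact: open_nbhs_nbhs.
  have [m me] : exists m : nat, m.+1%:R^-1 < e / 2.
    have [|m] := @ltr_add_invr R 0 (e / 2); first by rewrite divr_gt0.
    by rewrite add0r; exists m.
  have qP i : exists q : rat, tnth t i - m.+1%:R^-1 < ratr q < tnth t i + m.+1%:R^-1.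
    have := @rat_in_itvoo R (tnth t i - m.+1%:R^-1) (tnth t i + m.+1%:R^-1).
    case=> [|q]; first by rewrite ltrD2l gtrN.
    by rewrite in_itv; exists q.
  pose q := [ffun i => projT1 (cid (qP i))].
  have qE i : tnth t i - m.+1%:R^-1 < ratr (q i) < tnth t i + m.+1%:R^-1.
    by rewrite ffunE; case: cid.
  exists (m, q) => //; rewrite /F; case: pselect => [_ i|[]].
    exact: rbox_sym (qE i).
  move=> x xq; apply: eU; split=> // j i; rewrite ord1 mxE.
  exact: rbox_dist me (rbox_sym _ _ _ (qE i)) (xq i).
apply: countable_bigcupT_measurable; first exact: countableP.
move=> mq; rewrite /F; case: pselect => [boxU|_] /=; last exact: measurable0.
apply: (measurable_tuple_box (B := fun i => rbox mq.1.+1%:R^-1 (ratr (mq.2 i)))).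
by move=> i; exact: measurable_itv.
Qed.

Lemma measurable_compact_tuple_set K : compact K -> measurable (tuple_set K).
Proof.
move=> /(compact_closed (@norm_hausdorff _ _)) clK.
rewrite -[tuple_set K]setCK; apply/measurableC.
by apply: (@measurable_open_tuple_set (~` K)); exact: closed_openC.
Qed.

Lemma Vol_cube p (r : R) : 0 <= r -> Vol (cube p r) = (r ^+ n)%:E.
Proof.
move=> r0; pose side i : set T := `[p i, p i + r]%classic.
rewrite /Vol (_ : [set t | _] = [set t | forall i, side i (tnth t i)]).
  rewrite (@lebesgue_tuple_box R n side); last by move=> i; exact: measurable_itv.
  rewrite (eq_bigr (fun=> r%:E)); first by rewrite prodEFin prodr_const card_ord.
  move=> i _; rewrite lebesgue_measure_itv /= lte_fin ltrDl.
  have [r_gt0|r_le0] := ltP 0 r; first by rewrite -EFinB addrC addKr.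
  by congr (_%:E); apply/eqP; rewrite eq_le r0.
by apply/seteqP; split=> t c i; have := c i; rewrite /side /= in_itv /= mxE.
Qed.

Lemma Vol_fin_bound r K : 0 <= r -> convex_compact K -> width_le r K ->
  (0 <= Vol K <= (r ^+ n)%:E)%E.
Proof.
move=> r0 cK /width_le_cube[p Kp]; rewrite -(Vol_cube p r0) /Vol.
have [mu ->] := lebesgue_tuple_sigma_finite R n; rewrite measure_ge0 /=.
apply: le_measure; rewrite ?inE; [exact: measurable_compact_tuple_set cK.1| |].
  exact: measurable_compact_tuple_set (convex_compact_cube p r).1.
by move=> t; exact: Kp.
Qed.

Lemma Vol_fine K : convex_compact K -> (fine (Vol K))%:E = Vol K.
Proof.
move=> cK; have [r r0 /(Vol_fin_bound r0 cK)/andP[V0 Vr]] := compact_width_le cK.1.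
by rewrite fineK // ge0_fin_numE // (le_lt_trans Vr) // ltry.
Qed.

(** The halves [K `&` coord_ge i a] and [K `&` coord_le i a] cover [K] and meet in
    the section, so weak additivity is inclusion-exclusion. *)
Lemma coord_additive_Vol : coord_additive (fun K => fine (Vol K)).
Proof.
have [mu muE] := lebesgue_tuple_sigma_finite R n.
split=> [|i a K cK]; first by rewrite /Vol muE (_ : [set _ | _] = set0) ?measure0.
have [cge cle] := (coord_geI i a cK, coord_leI i a cK).
have ceq := coord_eqI i a cK.
apply: EFin_inj; rewrite !EFinD !Vol_fine //.
have volE A : Vol A = mu (tuple_set A) by rewrite /Vol muE.
have geoo : (mu (tuple_set (K `&` coord_ge i a)) < +oo)%E.
  by rewrite -volE -Vol_fine // ltry.
have eqfin : mu (tuple_set (K `&` coord_eq i a)) \is a fin_num.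
  by rewrite -volE -Vol_fine.
rewrite !volE.
have KE : tuple_set K =
    tuple_set (K `&` coord_ge i a) `|` tuple_set (K `&` coord_le i a).
  apply/seteqP; split=> t; last by move=> [[]|[]].
  rewrite /tuple_set /coord_ge /coord_le /= mxE => Kt.
  by have [ta|/ltW ta] := leP a (tnth t i); [left|right].
have eqE : tuple_set (K `&` coord_eq i a) =
    tuple_set (K `&` coord_ge i a) `&` tuple_set (K `&` coord_le i a).
  apply/seteqP; split=> t; rewrite /tuple_set /coord_eq /coord_ge /coord_le /= mxE.
    by move=> [Kt ->].
  by move=> [[Kt at_] [_ ta]]; split=> //; apply/eqP; rewrite eq_le ta.
have mge := measurable_compact_tuple_set cge.1; have mle := measurable_compact_tuple_set cle.1.
by rewrite KE (measureUfinl mge mle) // -eqE subeK.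
Qed.

Lemma width_bounded_Vol : width_bounded_on setT (fun K => fine (Vol K)) 1.
Proof.
move=> r K r0 cK _ wK; have /andP[V0 Vr] := Vol_fin_bound r0 cK wK.
rewrite mul1r ger0_norm ?fine_ge0 //.
by rewrite -lee_fin Vol_fine.
Qed.

End Volume.

(** * Translation invariant homogeneous valuations *)

Section Functional.
Context {R : realType} {n : nat}.
Implicit Types (K A : set 'rV[R]_n) (p : 'I_n -> R) (i : 'I_n).
Implicit Types V : set 'rV[R]_n -> R.

(** The value of [V] on the empty set is arbitrary, and has to be 0 for an
    additivity that also covers hyperplanes missing the body. *)
Definition extend0 V K := if pselect (K !=set0) then V K else 0.

Lemma extend0E V K : K !=set0 -> extend0 V K = V K.
Proof. by rewrite /extend0; case: pselect. Qed.

Lemma extend0_set0 V : extend0 V set0 = 0.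
Proof. by rewrite /extend0; case: pselect => //= -[]. Qed.

Lemma dotprod_delta i (x : 'rV[R]_n) : dotprod (delta_mx ord0 i) x = x ord0 i.
Proof.
rewrite /dotprod (bigD1 i) //= big1 ?addr0; last first.
  by move=> j ji; rewrite mxE eqxx (negbTE ji) mul0r.
by rewrite mxE !eqxx mul1r.
Qed.

(** If the hyperplane misses [K], then by convexity [K] lies on one side of it and
    the identity is trivial. *)
Lemma coord_additive_extend0 V : weakly_additive V -> coord_additive (extend0 V).
Proof.
move=> Vadd; split=> [|i a K cK]; first exact: extend0_set0.
have [K0|/eqP K0] := pselect (K = set0); first by rewrite K0 !set0I extend0_set0.
have {}K0 : K !=set0 by exact/set0P.
have [[w [Kw wa]]|Keq] := pselect (K `&` coord_eq i a !=set0).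
  have eq0 : K `&` coord_eq i a !=set0 by exists w.
  have ge0 : K `&` coord_ge i a !=set0.
    by exists w; split=> //; rewrite /coord_ge /= wa.
  have le0 : K `&` coord_le i a !=set0.
    by exists w; split=> //; rewrite /coord_le /= wa.
  rewrite !extend0E //; pose u : 'rV[R]_n := delta_mx ord0 i.
  have eqE : coord_eq i a = hyperplane u a.
    by apply/seteqP; split=> x; rewrite /coord_eq /hyperplane /= dotprod_delta.
  have geE : coord_ge i a = halfspace_ge u a.
    by apply/seteqP; split=> x; rewrite /coord_ge /halfspace_ge /= dotprod_delta.
  have leE : coord_le i a = halfspace_le u a.
    by apply/seteqP; split=> x; rewrite /coord_le /halfspace_le /= dotprod_delta.
  rewrite eqE geE leE; apply: Vadd; rewrite -?eqE -?geE -?leE ?convex_bodyE.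
  - by apply/eqP => /rowP/(_ i)/eqP; rewrite !mxE !eqxx oner_eq0.
  - by split.
  - by split=> //; exact: coord_eqI.
  - by split=> //; exact: coord_geI.
  - by split=> //; exact: coord_leI.
have side x y : K x -> K y -> x ord0 i <= a -> a <= y ord0 i -> False.
  move=> Kx Ky xa ay.
  have [t t01 tE] := between_convex_comb xa ay.
  apply: Keq; exists (t *: y + (1 - t) *: x); split; first exact: cK.2.
  by rewrite /coord_eq /= !mxE.
have [x Kx] := K0.
have -> : K `&` coord_eq i a = set0.
  by apply/eqP/negPn/negP => /set0P.
rewrite extend0_set0 addr0.
have [xa|/ltW ax] := leP (x ord0 i) a.
  have -> : K `&` coord_ge i a = set0.
    by apply/seteqP; split=> // y [Ky ay]; exact: (side x y).
  rewrite extend0_set0 add0r; congr extend0; apply/esym/setIidl => y Ky.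
  by rewrite /coord_le /= leNgt; apply/negP => /ltW ay; exact: (side x y).
have -> : K `&` coord_le i a = set0.
  by apply/seteqP; split=> // y [Ky ya]; exact: (side y x).
rewrite extend0_set0 addr0; congr extend0; apply/esym/setIidl => y Ky.
by rewrite /coord_ge /= leNgt; apply/negP => /ltW ya; exact: (side y x).
Qed.

Lemma convex_body_affine K (l : R) (x : 'rV[R]_n) :
  convex_body K -> convex_body [set l *: y + x | y in K].
Proof.
rewrite !convex_bodyE => -[[coK cvK] [w Kw]]; split; last by exists (l *: w + x), w.
split.
  apply: continuous_compact => //; apply: continuous_subspaceT => y.
  have cl : (fun z => l *: z) @ y --> l *: y by exact: scaler_continuous.
  have cx : (fun _ : 'rV[R]_n => x) @ y --> x by apply: (@cvg_cst _ x _ (nbhs y)).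
  exact: (cvgD cl cx).
move=> _ _ t [u Ku <-] [v Kv <-] t01.
exists (t *: u + (1 - t) *: v); first exact: cvK.
by apply/rowP => i; rewrite !mxE; ring.
Qed.

Lemma homothety_value V K (l : R) (x : 'rV[R]_n) :
  translation_invariant V -> homogeneous n%:R V -> 0 <= l -> convex_body K ->
  V [set l *: y + x | y in K] = l ^+ n * V K.
Proof.
move=> Vt Vh l0 cK.
have cl : convex_body [set l *: y | y in K].
  have := convex_body_affine l 0 cK; congr convex_body.
  by apply: eq_imagel => y _; rewrite addr0.
by rewrite -powR_mulrn // -Vh // -(Vt _ x cl) image_comp.
Qed.

(** [K] is the image of a subset [K'] of the unit ball by a homothety of ratio
    [n * r]: the coordinates of the points of [K'] are at most [1 / n] in absolute
    value, hence their Euclidean norm is at most 1.  If [r = 0] the ratio is 0,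
    and [K] is a point. *)
Lemma width_bounded_extend0 V : (0 < n)%N ->
  translation_invariant V -> homogeneous n%:R V -> bounded_on_unit_eball V ->
  exists2 C, 0 <= C & width_bounded_on setT (extend0 V) C.
Proof.
move=> n0 Vt Vh [M VM].
exists (`|M| * n%:R ^+ n); first by rewrite mulr_ge0 ?exprn_ge0.
move=> r K r0 cK _ wK.
have [K0|] := pselect (K !=set0); last first.
  by rewrite /extend0; case: pselect => //= _ _; rewrite normr0 !mulr_ge0 ?exprn_ge0.
rewrite extend0E //; have bK : convex_body K by rewrite convex_bodyE.
have [x0 Kx0] := K0; pose l := n%:R * r.
have l0 : 0 <= l by rewrite mulr_ge0.
pose K' := [set l^-1 *: y + - (l^-1 *: x0) | y in K].
have bK' : convex_body K' by exact: convex_body_affine.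
have nR : n%:R != 0 :> R by rewrite pnatr_eq0 -lt0n.
have KE : K = [set l *: y + x0 | y in K'].
  rewrite image_comp -[LHS]image_id; apply: eq_imagel => y Ky /=.
  rewrite -scalerBr scalerA; have [l_eq0|lN0] := eqVneq l 0; last first.
    by rewrite divff // scale1r subrK.
  have r_eq0 : r = 0 by move/eqP: l_eq0; rewrite mulf_eq0 (negbTE nR) => /eqP.
  rewrite l_eq0 mul0r scale0r add0r; apply/rowP => i.
  by have := wK y x0 i Ky Kx0; have := wK x0 y i Kx0 Ky; rewrite r_eq0; lra.
rewrite KE homothety_value // normrM ger0_norm ?exprn_ge0 // /l exprMn.
rewrite mulrC mulrA ler_wpM2r ?exprn_ge0 // ler_wpM2r ?exprn_ge0 //.
apply: le_trans (ler_norm M); apply: VM => // _ [y Ky <-].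
rewrite /unit_eball /= /enorm -[leRHS]sqrtr1 ler_wsqrtr // /dotprod.
have coord i : (l^-1 *: y + - (l^-1 *: x0)) ord0 i *
    (l^-1 *: y + - (l^-1 *: x0)) ord0 i <= n%:R^-1.
  rewrite !mxE -mulrBr; set d := y ord0 i - x0 ord0 i.
  have lr : l^-1 * r <= n%:R^-1.
    have [->|rN0] := eqVneq r 0; first by rewrite mulr0 invr_ge0.
    by rewrite /l invfM -mulrA mulVf // mulr1.
  have dr : `|l^-1 * d| <= n%:R^-1.
    apply: le_trans lr; rewrite normrM ger0_norm ?invr_ge0 // ler_wpM2l ?invr_ge0 //.
    by have := wK y x0 i Ky Kx0; have := wK x0 y i Kx0 Ky; rewrite ler_norml /d; lra.
  apply: le_trans (ler_norm _) _; rewrite normrM -[leRHS]mulr1 ler_pM //.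
  by apply: le_trans dr _; rewrite invf_le1 ?ler1n ?ltr0n.
apply: le_trans (ler_sum _ (fun i _ => coord i)) _.
by rewrite sumr_const card_ord -[leLHS]mulr_natr mulVf.
Qed.

Lemma extend0_cube V p (r : R) :
  translation_invariant V -> homogeneous n%:R V -> 0 <= r ->
  extend0 V (cube p r) = extend0 V (cube (fun=> 0) 1) * r ^+ n.
Proof.
move=> Vt Vh r0.
have ne q (d : R) : 0 <= d -> cube q d !=set0.
  by move=> d0; exists (\row_i q i) => i; rewrite mxE lexx lerDl.
rewrite !extend0E; [|exact: ne|exact: ne].
rewrite mulrC -(homothety_value (\row_i p i) Vt Vh r0); last first.
  by rewrite convex_bodyE; split; [exact: convex_compact_cube|exact: ne].
congr V; apply/seteqP; split=> [x cx|_ [y cy <-] i].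
  exists (r^-1 *: (x - \row_i p i)).
    move=> i; rewrite !mxE add0r; have /andP[px xp] := cx i.
    rewrite mulr_ge0 ?invr_ge0 ?subr_ge0 //=.
    have [->|rN0] := eqVneq r 0; first by rewrite invr0 mul0r.
    by rewrite mulrC ler_pdivrMr ?lt_neqAle 1?eq_sym ?rN0 //; lra.
  rewrite scalerA; have [r_eq0|rN0] := eqVneq r 0; last first.
    by rewrite divff // scale1r subrK.
  rewrite r_eq0 mul0r scale0r add0r; apply/rowP => i; rewrite mxE.
  by have := cx i; rewrite r_eq0; lra.
by have := cy i; rewrite !mxE; nra.
Qed.

End Functional.

Theorem theorem1p1 (R : realType) (n : nat) (n_gt0 : (0 < n)%N)
    (V : set 'rV[R]_n -> R)
    (V_add : weakly_additive V)
    (V_transl : translation_invariant V)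
    (V_hom : homogeneous n%:R V)
    (V_bounded : bounded_on_unit_eball V) :
  exists c : R, forall K : set 'rV[R]_n, convex_body K ->
    (V K)%:E = (c%:E * Vol K)%E.
Proof.
pose c := extend0 V (cube (fun=> 0) 1); exists c => K /convex_bodyE[cK K0].
pose W A := extend0 V A - c * fine (Vol A).
have [C C0 VC] := width_bounded_extend0 n_gt0 V_transl V_hom V_bounded.
have [V0 Vadd] := coord_additive_extend0 V_add.
have [Vol0 Voladd] := @coord_additive_Vol R n.
suff /eqP : W K = 0.
  by rewrite subr_eq0 extend0E // => /eqP ->; rewrite EFinM Vol_fine.
apply: (additive_vanish (C := C + `|c|)) => //.
- split=> [|i a A cA]; rewrite /W; first by rewrite V0 Vol0 mulr0 subrr.
  have := Vadd i a A cA; have := Voladd i a A cA.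
  rewrite addrACA -opprD -mulrDr => -> ->.
  by ring.
- exact: addr_ge0.
- move=> r A r0 cA _ wA; apply: le_trans (ler_normB _ _) _.
  rewrite mulrDl normrM lerD //; first exact: VC.
  rewrite ler_wpM2l //; apply: le_trans (width_bounded_Vol r0 cA I wA) _.
  by rewrite mul1r.
- by move=> p r r0; rewrite /W extend0_cube // Vol_cube // subrr.
Qed.
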